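(* Let $G$ and $H$ be finite graphs and let $R\subseteq V_G\times V_H$ be a relation with $G\ast R=H$. Then there exist a set $B$, an injective relation $R_D\subseteq \operatorname{dom}R\times B$ with full domain, and a functional relation $R_C\subseteq B\times\operatorname{img}R$ with full image such that $(G[\operatorname{dom}R]\ast R_D)\ast R_C=H$.
   Context: Graphs are finite and undirected, loops allowed; a graph is $G=(V_G,E_G)$ with $E_G\subseteq V_G\times V_G$ symmetric. $G[W]$ is the subgraph of $G$ induced by $W\subseteq V_G$. For a finite set $B$ and a relation $R\subseteq V_G\times B$ with full image (every $b\in B$ has some $v\in V_G$ with $(v,b)\in R$), $G\ast R$ is the graph with vertex set $B$ and edge set $\{(a,b)\in B\times B: \exists (u,v)\in E_G,\ (u,a)\in R,\ (v,b)\in R\}$; writing $G\ast R$ presupposes that $R$ has full image. For $R\subseteq X\times Y$: $\operatorname{dom}R=\{x:\exists y,(x,y)\in R\}$, $\operatorname{img}R=\{y:\exists x,(x,y)\in R\}$; $R$ has full domain if $\operatorname{dom}R=X$ and full image if $\operatorname{img}R=Y$; $R$ is injective if $(x,y),(z,y)\in R$ implies $x=z$; $R$ is functional if $(x,y),(x,z)\in R$ implies $y=z$. *)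

(* Defs.v *)
From HB Require Import structures.
From mathcomp Require Import all_boot.

Set Implicit Arguments.
Unset Strict Implicit.
Unset Printing Implicit Defensive.

(* A relation R between X : {set T} and Y : {set U} is an element of
   {set T * U} with R \subset setX X Y. *)

Section Relations.

Variables T U : finType.
Implicit Types (R : {set T * U}) (X : {set T}) (Y : {set U}).

Definition rdom R : {set T} := [set x | [exists y, (x, y) \in R]].

Definition rimg R : {set U} := [set y | [exists x, (x, y) \in R]].

Definition full_domain R X : Prop := rdom R = X.

Definition full_image R Y : Prop := rimg R = Y.

Definition rel_injective R : Prop :=
  forall x z y, (x, y) \in R -> (z, y) \in R -> x = z.

Definition rel_functional R : Prop :=
  forall x y z, (x, y) \in R -> (x, z) \in R -> y = z.

End Relations.

(* The vertex set is a subset of an ambient finite type, rather than the whole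
   type, so that graphs on different vertex sets (such as G[W], or graphs on
   the image of a relation) can be compared by Leibniz equality.  The two laws
   are boolean, hence proof-irrelevant: a graph is determined by its vertex and
   edge sets.  Loops are allowed. *)
Record graph (T : finType) := Graph {
  vertices : {set T};
  edges : {set T * T};
  edges_sub : edges \subset setX vertices vertices;
  edges_sym : [forall u, forall v, ((u, v) \in edges) ==> ((v, u) \in edges)]
}.

Section Induced.

Variables (T : finType) (G : graph T) (W : {set T}).

Definition induced_edges : {set T * T} :=
  [set p in edges G | (p.1 \in W) && (p.2 \in W)].

Fact induced_sub :
  induced_edges \subset setX (vertices G :&: W) (vertices G :&: W).
Proof.
apply/subsetP=> -[u v]; rewrite !inE /= => /andP[uvG /andP[uW vW]].
by have := subsetP (edges_sub G) _ uvG; rewrite inE /= uW vW !andbT.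
Qed.

Fact induced_sym :
  [forall u, forall v, ((u, v) \in induced_edges) ==>
                       ((v, u) \in induced_edges)].
Proof.
apply/forallP=> u; apply/forallP=> v; apply/implyP.
rewrite !inE /= => /andP[uvG /andP[-> ->]]; rewrite !andbT.
exact: (implyP (forallP (forallP (edges_sym G) u) v)).
Qed.

(* Meant for W \subset vertices G, in which case the vertex set is W. *)
Definition induced : graph T := Graph induced_sub induced_sym.

End Induced.

Section Star.

Variables (T U : finType) (G : graph T) (R : {set T * U}) (B : {set U}).

Definition star_edges : {set U * U} :=
  [set p in setX B B |
     [exists u, exists v, [&& (u, v) \in edges G,
                              (u, p.1) \in R & (v, p.2) \in R]]].

Fact star_sub : star_edges \subset setX B B.
Proof. by apply/subsetP=> p; rewrite inE => /andP[]. Qed.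

Fact star_sym :
  [forall a, forall b, ((a, b) \in star_edges) ==> ((b, a) \in star_edges)].
Proof.
apply/forallP=> a; apply/forallP=> b; apply/implyP.
rewrite !inE /= => /andP[/andP[-> ->]] /=.
move=> /existsP[u /existsP[v /and3P[uvG ua vb]]].
apply/existsP; exists v; apply/existsP; exists u; rewrite ua vb !andbT.
exact: (implyP (forallP (forallP (edges_sym G) u) v)).
Qed.

(* G * R for a relation R from the vertices of G to B.  The target B is an
   argument because R does not carry it.  The presuppositions on R are not
   built in: they are bundled in [star_relation], to be assumed alongside. *)
Definition star : graph U := Graph star_sub star_sym.

Definition star_relation : Prop :=
  R \subset setX (vertices G) B /\ full_image R B.

End Star.

(* Main.v *)
Require Import Defs.
From mathcomp Require Import all_boot.

(* Take B = R itself: the pair (x, y) is a copy of x, created by R_D from x and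
   contracted by R_C to y, so that R is the composite of R_D and R_C. *)

(** In the intermediate graph the vertices are the pairs in [R], and two pairs are adjacent exactly
    when their first components are adjacent in [G]. A pair determines both of its components, which
    makes [split_rel] injective and [merge_rel] functional. An edge of [star G R] is witnessed by an
    edge of [G] together with two pairs of [R], and these pairs are themselves adjacent vertices of
    the intermediate graph; [star_split_merge] turns this into an equality of graphs. *)

Lemma graph_eq (T : finType) (G H : graph T) :
  vertices G = vertices H -> edges G = edges H -> G = H.
Proof.
case: G H => V E s r [V' E' s' r'] /= eV eE; subst V' E'.
by rewrite (bool_irrelevance s s') (bool_irrelevance r r').
Qed.

Section Factorization.

Variables (T U : finType) (R : {set T * U}).

Definition split_rel : {set T * (T * U)} :=
  [set p | (p.2 \in R) && (p.2.1 == p.1)].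

Definition merge_rel : {set (T * U) * U} :=
  [set p | (p.1 \in R) && (p.1.2 == p.2)].

Lemma mem_split x p : ((x, p) \in split_rel) = (p \in R) && (p.1 == x).
Proof. by rewrite inE. Qed.

Lemma mem_merge p y : ((p, y) \in merge_rel) = (p \in R) && (p.2 == y).
Proof. by rewrite inE. Qed.

Lemma mem_rdom {x y} : (x, y) \in R -> x \in rdom R.
Proof. by move=> xyR; rewrite inE; apply/existsP; exists y. Qed.

Lemma mem_rimg {x y} : (x, y) \in R -> y \in rimg R.
Proof. by move=> xyR; rewrite inE; apply/existsP; exists x. Qed.

Lemma split_rel_sub : split_rel \subset setX (rdom R) R.
Proof.
apply/subsetP=> -[x [x' y]]; rewrite mem_split /= => /andP[xyR /eqP <-].
by rewrite in_setX xyR (mem_rdom xyR).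
Qed.

Lemma merge_rel_sub : merge_rel \subset setX R (rimg R).
Proof.
apply/subsetP=> -[[x y] y']; rewrite mem_merge /= => /andP[xyR /eqP <-].
by rewrite in_setX xyR (mem_rimg xyR).
Qed.

Lemma split_rel_injective : rel_injective split_rel.
Proof.
by move=> x z p; rewrite !mem_split => /andP[_ /eqP <-] /andP[_ /eqP <-].
Qed.

Lemma merge_rel_functional : rel_functional merge_rel.
Proof.
by move=> p y z; rewrite !mem_merge => /andP[_ /eqP <-] /andP[_ /eqP <-].
Qed.

Lemma rdom_split_rel : rdom split_rel = rdom R.
Proof.
apply/setP=> x; rewrite !inE; apply/existsP/existsP.
  by case=> -[x' y]; rewrite mem_split /= => /andP[xyR /eqP <-]; exists y.
by case=> y xyR; exists (x, y); rewrite mem_split /= xyR eqxx.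
Qed.

Lemma rimg_split_rel : rimg split_rel = R.
Proof.
apply/setP=> p; rewrite inE; apply/existsP/idP.
  by case=> x; rewrite mem_split => /andP[].
by move=> pR; exists p.1; rewrite mem_split pR eqxx.
Qed.

Lemma rimg_merge_rel : rimg merge_rel = rimg R.
Proof.
apply/setP=> y; rewrite !inE; apply/existsP/existsP.
  by case=> -[x y']; rewrite mem_merge /= => /andP[xyR /eqP <-]; exists x.
by case=> x xyR; exists (x, y); rewrite mem_merge /= xyR eqxx.
Qed.

(** Restricting [G] to [rdom R] loses no edge here, since both endpoints of a witnessing edge are
    related by [R] to something. *)
Lemma star_split_merge (G : graph T) :
  star (star (induced G (rdom R)) split_rel R) merge_rel (rimg R)
  = star G R (rimg R).
Proof.
apply: graph_eq => //=; apply/setP=> -[a b]; rewrite !inE /=.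
congr (_ && _); apply/existsP/existsP.
  (* Contraction forces the second components to be [a] and [b]; splitting forces the first
     components to be the endpoints of an edge of [G]. *)
  case=> -[u a'] /existsP[[v b'] /and3P[]]; rewrite !mem_merge /=.
  move=> uvE /andP[uR /eqP <-] /andP[vR /eqP <-].
  move: uvE; rewrite inE /= => /andP[_] /existsP[u'] /existsP[v'] /and3P[].
  rewrite inE !mem_split /= => /andP[uvG _] /andP[_ /eqP eu] /andP[_ /eqP ev].
  by exists u'; apply/existsP; exists v'; rewrite uvG -eu -ev uR vR.
case=> u /existsP[v /and3P[uvG uR vR]].
(* The copies of [u] and [v] to use are those indexed by their targets. *)
exists (u, a); apply/existsP; exists (v, b).
rewrite !mem_merge /= uR vR !eqxx !andbT inE in_setX /= uR vR /=.
apply/existsP; exists u; apply/existsP; exists v.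
by rewrite !mem_split /= uR vR !eqxx !andbT inE /= uvG (mem_rdom uR) (mem_rdom vR).
Qed.

End Factorization.

Arguments split_rel {T U}.
Arguments merge_rel {T U}.

Theorem corollary4p1p3 (T U : finType) (G : graph T) (H : graph U)
    (R : {set T * U})
    (hR : star_relation G R (vertices H))
    (hGRH : star G R (vertices H) = H) :
  exists (S : finType) (B : {set S}) (RD : {set T * S}) (RC : {set S * U}),
    [/\ [/\ RD \subset setX (rdom R) B,
            rel_injective RD & full_domain RD (rdom R)],
        [/\ RC \subset setX B (rimg R),
            rel_functional RC & full_image RC (rimg R)],
        star_relation (induced G (rdom R)) RD B,
        star_relation (star (induced G (rdom R)) RD B) RC (rimg R)
      & star (star (induced G (rdom R)) RD B) RC (rimg R) = H].
Proof.
case: hR => RsubGH imgR.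
(* The vertex set of [induced] is an intersection with [vertices G]; this inclusion collapses it to
   [rdom R]. *)
have domG : rdom R \subset vertices G.
  apply/subsetP=> x; rewrite inE => /existsP[y /(subsetP RsubGH)].
  by rewrite in_setX => /andP[].
exists (T * U)%type, R, (split_rel R), (merge_rel R); split.
- split; [exact: split_rel_sub | exact: split_rel_injective |].
  exact: rdom_split_rel.
- split; [exact: merge_rel_sub | exact: merge_rel_functional |].
  exact: rimg_merge_rel.
- split; last exact: rimg_split_rel.
  by rewrite /= (setIidPr domG) split_rel_sub.
- by split; [exact: merge_rel_sub | exact: rimg_merge_rel].
- by rewrite star_split_merge imgR.
Qed.
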